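(* The join-irreducible elements of the Motzkin lattice $\mathcal{M}_n$ are exactly the Motzkin paths consisting of a single peak and horizontal steps on the $x$-axis, i.e. the paths of the form $$H^{i}\,U^{h}D^{h}\,H^{n-j},\qquad 0\le i<j\le n,\ j-i=2h,\ h\ge1.$$ The spectrum of $\mathcal{M}_n$ (the poset of its join-irreducibles) is isomorphic to the poset of the intervals of even (positive) length of a chain having $n+1$ elements: $$\mathbf{Spec}(\mathcal{M}_n)\simeq\{(i,j)\in\mathcal{C}_n^2 : \exists k\in\mathbb{N}\ (j-i=2k+2)\}.$$
   Context: The Motzkin lattice $\mathcal{M}_n$ is the set of Motzkin paths of length $n$, i.e. functions $f:\{0,\ldots,n\}\to\mathbb{N}$ with $f(0)=f(n)=0$ and $f(k+1)-f(k)\in\{1,0,-1\}$, ordered by $f\le g$ iff $f(k)\le g(k)$ for all $k$. It is a finite distributive lattice with minimum $\widehat0=H^n$. Paths are written as words in $U=(1,1)$, $H=(1,0)$, $D=(1,-1)$. A join-irreducible element is an $x\ne\widehat0$ such that $x=u\vee v$ implies $x=u$ or $x=v$; $\mathbf{Spec}$ is the set of join-irreducibles with the induced order. $\mathcal{C}_n$ is the chain $\{0<1<\cdots<n\}$. The pairs $(i,j)$ are thought of as intervals $[i,j]$ and ordered by inclusion: $(i,j)\le(i',j')$ iff $i'\le i$ and $j\le j'$. *)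

(* Defs.v *)
From HB Require Import structures.
From mathcomp Require Import all_boot all_order all_algebra.
From mathcomp Require Import zify.
From mathcomp Require Import boolp classical_sets.

Set Implicit Arguments.
Unset Strict Implicit.
Unset Printing Implicit Defensive.

Import Order.TTheory GRing.Theory.
Local Open Scope order_scope.

Section JoinIrreducible.
Context {d : Order.disp_t} {L : bJoinSemilatticeType d}.

Definition join_irreducible (x : L) : Prop :=
  x <> \bot /\ forall u v : L, x = u `|` v -> x = u \/ x = v.

End JoinIrreducible.

(* A subset of a poset always carries the induced order. *)
Definition Spec {d : Order.disp_t} (L : bJoinSemilatticeType d) : set L :=
  [set x | join_irreducible x]%classic.
Arguments Spec {d} L.

Definition poset_isomorphic {d d' : Order.disp_t}
    {P : porderType d} {Q : porderType d'} (A : set P) (B : set Q) : Prop :=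
  exists f : set_type A -> set_type B,
    bijective f /\
    forall x y : set_type A, (val (f x) <= val (f y)) = (val x <= val y).

Section Motzkin.
Variable n : nat.

(* The abscissas 0, ..., n are the elements of 'I_n.+1; for k : 'I_n, the two
   elements below are k and k + 1. *)
Definition pos (k : 'I_n) : 'I_n.+1 := widen_ord (leqnSn n) k.
Definition posS (k : 'I_n) : 'I_n.+1 := lift ord0 k.

Definition is_motzkin (f : {ffun 'I_n.+1 -> nat}) : bool :=
  [&& f ord0 == 0%N, f ord_max == 0%N &
    [forall k : 'I_n,
      ((f (posS k))%:Z - (f (pos k))%:Z)%R \in [:: 1; 0; -1]%R]].

Record motzkin := Motzkin {
  motzkin_fun :> {ffun 'I_n.+1 -> nat};
  motzkinP : is_motzkin motzkin_fun
}.

HB.instance Definition _ := [isSub for motzkin_fun].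
HB.instance Definition _ := [Choice of motzkin by <:].

Lemma motzkin_ext (f g : motzkin) : (forall k, f k = g k) -> f = g.
Proof. by move=> fg; apply/val_inj/ffunP. Qed.

Lemma is_motzkin_op (op : nat -> nat -> nat) (f g : motzkin) :
    (op 0 0 = 0)%N ->
    (forall a b a' b' : nat, (a' <= a.+1 -> a <= a'.+1 ->
       b' <= b.+1 -> b <= b'.+1 ->
       op a' b' <= (op a b).+1 /\ op a b <= (op a' b').+1)%N) ->
  is_motzkin [ffun k => op (f k) (g k)].
Proof.
move=> op0 opS; have /and3P[/eqP f0 /eqP fn /forallP fS] := motzkinP f.
have /and3P[/eqP g0 /eqP gn /forallP gS] := motzkinP g.
apply/and3P; split; rewrite ?ffunE ?f0 ?g0 ?fn ?gn ?op0 //.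
apply/forallP => k; rewrite !ffunE.
have := fS k; have := gS k; rewrite !inE => Hg Hf.
have [||||] := opS (f (pos k)) (g (pos k)) (f (posS k)) (g (posS k)).
all: lia.
Qed.

Lemma motzkin_join_subproof (f g : motzkin) :
  is_motzkin [ffun k => maxn (f k) (g k)].
Proof. by apply: is_motzkin_op => // *; lia. Qed.

Lemma motzkin_meet_subproof (f g : motzkin) :
  is_motzkin [ffun k => minn (f k) (g k)].
Proof. by apply: is_motzkin_op => // *; lia. Qed.

Lemma motzkin_bot_subproof : is_motzkin [ffun=> 0%N].
Proof.
by apply/and3P; split; rewrite ?ffunE //; apply/forallP => k; rewrite !ffunE.
Qed.

Definition motzkin_le (f g : motzkin) : bool := [forall k, (f k <= g k)%N].
Definition motzkin_join (f g : motzkin) := Motzkin (motzkin_join_subproof f g).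
Definition motzkin_meet (f g : motzkin) := Motzkin (motzkin_meet_subproof f g).
Definition motzkin_bot := Motzkin motzkin_bot_subproof.

Fact motzkin_le_refl : reflexive motzkin_le.
Proof. by move=> f; apply/forallP. Qed.

Fact motzkin_le_anti : antisymmetric motzkin_le.
Proof.
move=> f g /andP[/forallP fg /forallP gf]; apply: motzkin_ext => k.
by apply/eqP; rewrite eqn_leq fg gf.
Qed.

Fact motzkin_le_trans : transitive motzkin_le.
Proof.
move=> g f h /forallP fg /forallP gh; apply/forallP => k.
exact: leq_trans (fg k) (gh k).
Qed.

Fact motzkin_display : Order.disp_t. Proof. exact: Order.Disp tt tt. Qed.

HB.instance Definition _ := Order.Le_isPOrder.Build motzkin_display motzkin
  motzkin_le_refl motzkin_le_anti motzkin_le_trans.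

Fact motzkin_meetP (f g h : motzkin) :
  (f <= motzkin_meet g h) = (f <= g) && (f <= h).
Proof.
apply/forallP/andP => [fgh|[/forallP fg /forallP fh] k].
  by split; apply/forallP => k; have := fgh k; rewrite ffunE leq_min => /andP[].
by rewrite ffunE leq_min fg fh.
Qed.

Fact motzkin_joinP (f g h : motzkin) :
  (motzkin_join f g <= h) = (f <= h) && (g <= h).
Proof.
apply/forallP/andP => [fgh|[/forallP fh /forallP gh] k].
  by split; apply/forallP => k; have := fgh k; rewrite ffunE geq_max => /andP[].
by rewrite ffunE geq_max fh gh.
Qed.

HB.instance Definition _ := Order.POrder_MeetJoin_isLattice.Build
  motzkin_display motzkin motzkin_meetP motzkin_joinP.

Fact motzkin_meetUl :
  @left_distributive motzkin motzkin (@Order.meet _ _) (@Order.join _ _).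
Proof. by move=> f g h; apply: motzkin_ext => k; rewrite !ffunE minn_maxl. Qed.

HB.instance Definition _ := Order.Lattice_Meet_isDistrLattice.Build
  motzkin_display motzkin motzkin_meetUl.

Fact motzkin_le0 (f : motzkin) : motzkin_bot <= f.
Proof. by apply/forallP => k; rewrite ffunE. Qed.

HB.instance Definition _ := Order.hasBottom.Build
  motzkin_display motzkin motzkin_le0.

End Motzkin.

Inductive step := U | H | D.

Definition step_of (a b : nat) : step :=
  if (a < b)%N then U else if a == b then H else D.

Definition word n (f : motzkin n) : seq step :=
  [seq step_of (f (pos k)) (f (posS k)) | k <- enum 'I_n].

(* The pair (i, j) stands for the interval [i, j] of the chain 0 < ... < n;
   dualising the first factor of the componentwise order gives inclusion,
   see le_chain_pair. *)
Notation chain_pair n := (('I_n.+1)^d *p 'I_n.+1)%type.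

Definition left_end n (p : chain_pair n) : 'I_n.+1 := p.1.
Definition right_end n (p : chain_pair n) : 'I_n.+1 := p.2.

Lemma le_chain_pair n (p q : chain_pair n) :
  (p <= q) = (left_end q <= left_end p)%N && (right_end p <= right_end q)%N.
Proof. by []. Qed.

(* Truncated subtraction is harmless: a positive difference forces i < j. *)
Definition even_intervals n : set (chain_pair n) :=
  [set p | exists k : nat,
     (right_end p - left_end p = 2 * k + 2)%N]%classic.
Arguments even_intervals n : clear implicits.

(* Main.v *)
Require Import Defs.
From mathcomp Require Import all_boot all_order all_algebra.
From mathcomp Require Import zify.
From mathcomp Require Import boolp classical_sets.

(* Let T(c, h) be the path with a single peak, of height h, at abscissa c.
   Motzkin paths are 1-Lipschitz, so T(c, h) <= f iff h <= f(c).  Hence every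
   path f is the join of the T(k, f(k)), so a join-irreducible f is one of
   these; conversely, if T(c, h) = u \/ v, then u(c) = h or v(c) = h, so u or v
   dominates T(c, h).  The same equivalence turns T(c, h) <= T(c', h') into
   h <= h' - |c - c'|, i.e. into the inclusion of [c - h, c + h] in
   [c' - h', c' + h']. *)

Set Implicit Arguments.
Unset Strict Implicit.
Unset Printing Implicit Defensive.

Import Order.TTheory.
Local Open Scope order_scope.

(** Induction on [s]: the empty join is [\bot], which a join-irreducible is not, and each further
    element splits off by irreducibility. *)
Lemma join_irreducible_big d (L : bJoinSemilatticeType d) (I : Type)
    (s : seq I) (F : I -> L) (x : L) :
  join_irreducible x -> x = \join_(i <- s) F i -> exists i, x = F i.
Proof.
move=> [x0 xirr]; elim: s => [|i s IHs]; first by rewrite big_nil => /x0.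
by rewrite big_cons => /xirr[->|/IHs]; first by exists i.
Qed.

(** A map that preserves and reflects order is injective by antisymmetry, so surjectivity suffices;
    choice supplies the inverse. *)
Lemma poset_isomorphic_sym_surj d d' (P : porderType d) (Q : porderType d')
    (A : set P) (B : set Q) (g : set_type B -> set_type A) :
  (forall p q, (val (g p) <= val (g q)) = (val p <= val q)) ->
  (forall x, exists p, g p = x) -> poset_isomorphic A B.
Proof.
move=> gle /choice[f fK]; exists f; split; last by move=> x y; rewrite -gle !fK.
exists g => // p; apply/val_inj/le_anti.
by rewrite -!gle fK lexx.
Qed.

Section MotzkinPaths.
Variable n : nat.
Implicit Types (f g : motzkin n) (k : 'I_n).

Lemma val_posS k : posS k = k.+1 :> nat. Proof. exact: lift0. Qed.

Lemma motzkin_first f : f ord0 = 0%N.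
Proof. by case/and3P: (motzkinP f) => /eqP. Qed.

Lemma motzkin_last f : f ord_max = 0%N.
Proof. by case/and3P: (motzkinP f) => _ /eqP. Qed.

Lemma motzkin_step f k :
  (f (posS k) <= (f (pos k)).+1 /\ f (pos k) <= (f (posS k)).+1)%N.
Proof.
case/and3P: (motzkinP f) => _ _ /forallP/(_ k); rewrite !inE; lia.
Qed.

Lemma abscissa_ind (P : 'I_n.+1 -> Prop) :
  P ord0 -> (forall k, P (pos k) -> P (posS k)) -> forall a, P a.
Proof.
move=> P0 PS [a lta]; elim: a lta => [|a IHa] lta.
  by rewrite (_ : Ordinal lta = ord0) //; apply: val_inj.
have ltan : (a < n)%N by [].
rewrite (_ : Ordinal lta = posS (Ordinal ltan)); last first.
  by apply: ord_inj; rewrite val_posS.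
by apply: PS; rewrite (_ : pos _ = Ordinal (ltnW lta)) //; apply: val_inj.
Qed.

Lemma motzkin_lipschitz f (a b : 'I_n.+1) :
  (a <= b)%N -> (f a <= f b + (b - a) /\ f b <= f a + (b - a))%N.
Proof.
elim/abscissa_ind: b => [a0|k IHk].
  by rewrite (_ : a = ord0); [lia | apply: ord_inj; move: a0 => /=; lia].
rewrite val_posS => ak; have [ak'|ka] := leqP a (pos k).
  by have := IHk ak'; have := motzkin_step f k; move: ak' => /=; lia.
rewrite (_ : a = posS k); first by lia.
by apply: ord_inj; rewrite val_posS; move: ka => /=; lia.
Qed.

Lemma motzkin_height f (a : 'I_n.+1) : (f a <= a <= n - f a)%N.
Proof.
have := @motzkin_lipschitz f ord0 a; have := @motzkin_lipschitz f a ord_max.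
rewrite motzkin_first motzkin_last /=; have := ltn_ord a; lia.
Qed.

(* The double truncated subtraction is [h - |k - c|], cut off at 0. *)
Definition tent_height (c h k : nat) : nat := h - (k - c) - (c - k).

(** The hypothesis puts the base [c - h, c + h] inside [0, n], so both end heights vanish. The case
    h = 0 is allowed and gives the bottom path, so a tent exists at every point of a path. *)
Lemma tent_subproof (c h : nat) : (h <= c <= n - h)%N ->
  is_motzkin [ffun a : 'I_n.+1 => tent_height c h a].
Proof.
move=> ch; rewrite /is_motzkin !ffunE /tent_height /=.
apply/and3P; split; [lia | lia |].
by apply/forallP => k; rewrite !ffunE /= !inE /bump /=; lia.
Qed.

Definition tent c h (ch : (h <= c <= n - h)%N) : motzkin n :=
  Motzkin (tent_subproof ch).

Lemma tentE c h (ch : (h <= c <= n - h)%N) a : tent ch a = tent_height c h a.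
Proof. by rewrite ffunE. Qed.

Lemma tent_le c h (ch : (h <= c <= n - h)%N) f (a : 'I_n.+1) :
  a = c :> nat -> (tent ch <= f) = (h <= f a)%N.
Proof.
move=> ac; apply/forallP/idP => [/(_ a)|hfa b]; rewrite tentE /tent_height.
  by rewrite ac; lia.
have [/(motzkin_lipschitz f)|/ltnW/(motzkin_lipschitz f)] := leqP a b; lia.
Qed.

Lemma join_irreducible_tent c h (ch : (h <= c <= n - h)%N) :
  (0 < h)%N -> join_irreducible (tent ch).
Proof.
move=> h_gt0; have cn : (c < n.+1)%N by lia.
have le_tent f := @tent_le c h ch f (Ordinal cn) erefl.
split=> [t0|u v tuv].
  by have := lexx (tent ch); rewrite {2}t0 le_tent ffunE; lia.
have : (tent ch <= u) || (tent ch <= v).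
  rewrite !le_tent -leq_max.
  (* Reflexivity, with the right-hand tent replaced by the join, says that h is at most the maximum
     of u(c) and v(c). *)
  by have := lexx (tent ch); rewrite {2}tuv le_tent ffunE.
by case/orP=> [tu|tv]; [left|right]; apply: le_anti; rewrite ?tu ?tv tuv;
  rewrite ?leUl ?leUr.
Qed.

Lemma motzkin_join_tents f : f = \join_a tent (motzkin_height f a).
Proof.
apply: le_anti; apply/andP; split; last first.
  by apply/joinsP => a _; rewrite (tent_le _ _ (erefl (a : nat))).
apply/forallP => a; rewrite -(tent_le (motzkin_height f a) _ erefl).
exact: joins_sup.
Qed.

Lemma join_irreducibleP f : join_irreducible f <->
  exists c h (ch : (h <= c <= n - h)%N), (0 < h)%N /\ f = tent ch.
Proof.
split=> [firr|[c [h [ch [h_gt0 ->]]]]]; last exact: join_irreducible_tent.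
have [a fa] := join_irreducible_big firr (motzkin_join_tents f).
exists a, (f a), (motzkin_height f a); split=> //; rewrite lt0n.
(* An apex of height 0 would make [f] the bottom path. *)
apply/eqP => fa0; apply: firr.1; apply: le_anti; rewrite le0x andbT.
by rewrite fa (tent_le _ _ (erefl (a : nat))) fa0.
Qed.

(** A tent with h = 0 lies below every tent, wherever c is; h > 0 also makes the truncated height of
    the larger tent at c an exact difference. *)
Lemma tent_le_tent c h c' h' (ch : (h <= c <= n - h)%N)
    (ch' : (h' <= c' <= n - h')%N) : (0 < h)%N ->
  (tent ch <= tent ch') = (c' - h' <= c - h)%N && (c + h <= c' + h')%N.
Proof.
move=> h_gt0; have cn : (c < n.+1)%N by lia.
by rewrite (@tent_le _ _ _ _ (Ordinal cn)) // tentE /tent_height /=; lia.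
Qed.

(** Heights are rebuilt from 0 letter by letter. The letter [D] is the default of [step_of], but
    [motzkin_step] forces the drop to be exactly 1. *)
Lemma word_inj : injective (@word n).
Proof.
move=> f g /eq_in_map fg; apply: motzkin_ext.
apply: abscissa_ind => // [|k IHk]; first by rewrite !motzkin_first.
have := fg k (mem_enum _ _); have := motzkin_step f k.
have := motzkin_step g k; rewrite /step_of IHk.
by do 4?case: ifP => //; lia.
Qed.

Lemma word_tent c h (ch : (h <= c <= n - h)%N) :
  word (tent ch) =
    nseq (c - h) H ++ nseq h U ++ nseq h D ++ nseq (n - (c + h)) H.
Proof.
apply: (@eq_from_nth _ H) => [|k].
  by rewrite !size_cat !size_nseq size_map size_enum_ord; lia.
rewrite size_map size_enum_ord => kn.
rewrite (nth_map (Ordinal kn)) ?size_enum_ord //.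
rewrite (_ : nth _ _ _ = Ordinal kn); last first.
  by apply: ord_inj; rewrite nth_enum_ord.
rewrite !nth_cat !size_nseq !nth_nseq !tentE val_posS /= /step_of /tent_height.
by do !case: ifP => //; lia.
Qed.

Lemma join_irreducible_word f : join_irreducible f <->
  exists i j h : nat,
    [/\ (i < j <= n)%N, (j - i = 2 * h)%N, (1 <= h)%N
      & word f = nseq i H ++ nseq h U ++ nseq h D ++ nseq (n - j) H].
Proof.
rewrite join_irreducibleP; split=> [[c [h [ch [h_gt0 ->]]]]|].
  by exists (c - h)%N, (c + h)%N, h; split; rewrite ?word_tent //; lia.
move=> [i [j [h [ijn ji h_gt0 wf]]]].
have ch : (h <= i + h <= n - h)%N by lia.
(* The apex lies over the midpoint of [i, j]. *)
exists (i + h)%N, h, ch; split=> //; apply: word_inj; rewrite word_tent wf.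
by rewrite addnK (_ : i + h + h = j)%N //; lia.
Qed.

End MotzkinPaths.

Section Intervals.
Variable n : nat.
Implicit Type p : set_type (even_intervals n).

(** Height of the peak that stands on the interval; the halving is exact because the length is
    even. *)
Definition half_length p : nat := (right_end (val p) - left_end (val p))./2.
Definition middle p : nat := (left_end (val p) + half_length p)%N.

Lemma interval_bounds p :
  [/\ (0 < half_length p)%N, (middle p - half_length p = left_end (val p))%N
    & (middle p + half_length p = right_end (val p))%N].
Proof.
have [k kP] := set_mem (valP p); rewrite /middle /half_length; split; lia.
Qed.

Lemma interval_height p : (half_length p <= middle p <= n - half_length p)%N.
Proof.
have [] := interval_bounds p; have := ltn_ord (right_end (val p)).
by rewrite /middle; lia.
Qed.

Definition interval_tent p : set_type (Spec (motzkin n)) :=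
  SigSub (mem_set (join_irreducible_tent (interval_height p)
    (let: And3 h_gt0 _ _ := interval_bounds p in h_gt0))).

Lemma interval_tent_le p q :
  (val (interval_tent p) <= val (interval_tent q)) = (val p <= val q).
Proof.
have [h_gt0 lp rp] := interval_bounds p; have [_ lq rq] := interval_bounds q.
by rewrite /= tent_le_tent // lp rp lq rq le_chain_pair.
Qed.

Lemma interval_tent_surj x : exists p, interval_tent p = x.
Proof.
have /join_irreducibleP[c [h [ch [h_gt0 xE]]]] := set_mem (valP x).
have ln : (c - h < n.+1)%N by lia.
have rn : (c + h < n.+1)%N by lia.
pose q : chain_pair n := (Ordinal ln, Ordinal rn).
have qP : q \in even_intervals n.
  (* The base has length 2h = 2(h - 1) + 2. *)
  by apply: mem_set; exists h.-1; rewrite /left_end /right_end /=; lia.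
exists (SigSub qP); apply: val_inj; rewrite xE.
have [pos_h lq rq] := interval_bounds (SigSub qP).
(* Antisymmetry reduces equality of the tents to equality of their bases, without rewriting c and h
   under the dependent proof [ch]. *)
apply: le_anti; rewrite /= !tent_le_tent // lq rq /left_end /right_end /=.
by rewrite !leqnn.
Qed.

End Intervals.

Theorem proposition4p1 (n : nat) :
  (forall x : motzkin n,
     join_irreducible x <->
     exists i j h : nat,
       [/\ (i < j <= n)%N, (j - i = 2 * h)%N, (1 <= h)%N
         & word x = nseq i H ++ nseq h U ++ nseq h D ++ nseq (n - j) H])
  /\ poset_isomorphic (Spec (motzkin n)) (even_intervals n).
Proof.
split; first exact: join_irreducible_word.
exact: poset_isomorphic_sym_surj (@interval_tent_le n) (@interval_tent_surj n).
Qed.
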